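(* Let $G=(V,E,s,t)$ be a directed multigraph with finite arc set $E$ and two distinguished vertices $s,t\in V$ (possibly equal). Let $\mathcal{PM}(G)$ be the path-missing complex of $G$, regarded as a set of subsets of $E$. (a) If $G$ contains a useless arc or a cycle, or satisfies ($E=\varnothing$ and $s\neq t$), then the number $\#(\mathcal{PM}(G))$ of faces is even. (b) Otherwise, $\#(\mathcal{PM}(G))$ is odd.
   Context: Graphs are directed multigraphs; each arc has a source and a target in $V$; parallel arcs and self-loops are allowed. A walk from $v_0$ to $v_n$ is a sequence $(v_0,e_1,v_1,\ldots,e_n,v_n)$ with $n\ge 0$, $v_i\in V$, $e_i\in E$, where each $e_i$ is an arc from $v_{i-1}$ to $v_i$. A path is a walk that does not visit any vertex more than once; an $s-t$-path is a path from $s$ to $t$ (if $s=t$, this is the trivial path with no arcs). A cycle is a walk with $n\ge1$, $v_0=v_n$ and $v_0,\ldots,v_{n-1}$ distinct (so a self-loop gives a cycle). A useless arc is an arc that belongs to no $s-t$-path. A set $F\subseteq E$ contains a path if it contains every arc of it. The path-missing complex is $\mathcal{PM}(G)=\{F\subseteq E : E\setminus F \text{ contains an } s-t\text{-path}\}$; its elements (including possibly $\varnothing$) are its faces. *)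

(* Defs.v *)
From mathcomp Require Import all_boot.
From mathcomp Require Import boolp.

Set Implicit Arguments.
Unset Strict Implicit.
Unset Printing Implicit Defensive.

(* Only the arc set is finite; the vertex set may be infinite. *)
Record multidigraph (V : eqType) (E : finType) := Multidigraph {
  source : E -> V;
  target : E -> V
}.

Section Walks.
Variables (V : eqType) (E : finType) (G : multidigraph V E).
Implicit Types (u v : V) (w : seq (E * V)).

(* The walk (v_0, e_1, v_1, ..., e_n, v_n) is encoded by its initial vertex v_0
   together with w = [:: (e_1, v_1); ...; (e_n, v_n)]. *)
Definition walk_arcs w : seq E := map fst w.

(* v_1, ..., v_n, without v_0 *)
Definition walk_steps w : seq V := map snd w.

Fixpoint walk_from u w : bool :=
  if w is (e, v) :: w' then
    [&& source G e == u, target G e == v & walk_from v w']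
  else true.

Definition is_walk u v w : bool :=
  walk_from u w && (last u (walk_steps w) == v).

Definition is_path u v w : bool :=
  is_walk u v w && uniq (u :: walk_steps w).

(* belast v [:: v_1; ...; v_n] is the sequence v, v_1, ..., v_(n-1). *)
Definition is_cycle v w : bool :=
  [&& is_walk v v w, 0 < size w & uniq (belast v (walk_steps w))].

Definition has_cycle : Prop := exists v w, is_cycle v w.

Variables s t : V.

Definition useless (e : E) : Prop :=
  ~ exists w, is_path s t w /\ e \in walk_arcs w.

Definition contains_path (F : {set E}) : Prop :=
  exists w, is_path s t w /\ {subset walk_arcs w <= F}.

(* The walks do not form a finite type, so membership is decided classically
   through `[< _ >]. *)
Definition path_missing : {set {set E}} :=
  [set F : {set E} | `[< contains_path (~: F) >]].

End Walks.

(* Main.v *)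
Require Import Defs.
From mathcomp Require Import all_boot.
From mathcomp Require Import boolp.

Set Implicit Arguments.
Unset Strict Implicit.
Unset Printing Implicit Defensive.

(** All counting is modulo 2, and isolated vertices are ignored. An arc whose
    source is not reached from [s] may be added or removed without changing the
    set of reached vertices. If no arc is useless, every vertex other than [t]
    has an outgoing arc; so toggling an arc with unreached source shows that,
    among the arc sets reaching [t], those not reaching every vertex cancel out.

    Let [K] be the set of vertices from which a cycle can be reached. The arc
    sets reaching every vertex are those which contain an arc into every vertex
    outside [K] and reach all of [K]: going backwards along arcs, from any
    vertex, one arrives at [s] or in [K]. The last condition can be dropped
    modulo 2, because a vertex of [K] has an outgoing arc into [K], which can be
    toggled if the vertex is not reached. What remains are the arc sets
    containing an arc into every vertex outside [K]. If there is a cycle, an arc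
    into [K] can be toggled freely, and their number is even. If not, every
    vertex [v] other than [s] contributes a factor [2 ^ indegree(v) - 1], and it
    is odd. *)

(** * Parity by fixed-point-free involutions *)

Lemma even_card_involution (T : finType) (X : {set T}) (g : T -> T) :
  {in X, forall x, g x \in X} -> {in X, involutive g} ->
  {in X, forall x, g x != x} -> ~~ odd #|X|.
Proof.
have [n] := ubnP #|X|; elim: n X => // n IHn X ltXn gX gK gN.
have [->|[x xX]] := set_0Vmem X; first by rewrite cards0.
have gxX : g x \in X :\ x by rewrite in_setD1 gN ?gX.
(* Removing the orbit of [x] takes away two elements and leaves a set stable under [g]. *)
rewrite (cardsD1 x) xX (cardsD1 (g x)) gxX /= negbK.
have sub y : y \in X :\ x :\ g x -> y \in X by rewrite !inE => /and3P[].
apply: IHn => [|y|y|y].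
- by move: ltXn; rewrite (cardsD1 x) xX (cardsD1 (g x)) gxX => /ltnW.
- rewrite !inE => /and3P[yNgx yNx yX]; rewrite gX // andbT.
  apply/andP; split; last by apply: contra yNgx => /eqP <-; rewrite gK.
  by apply: contra yNx => /eqP e; rewrite -(gK y) // e gK.
- by move=> /sub /gK.
- by move=> /sub /gN.
Qed.

Section Flip.
Variable E : finType.
Implicit Types (A B : {set E}) (X : {set {set E}}).

Definition flip B A : {set E} := [set x | (x \in A) (+) (x \in B)].

Lemma flipK B : involutive (flip B).
Proof. by move=> A; apply/setP=> x; rewrite !inE addbK. Qed.

(* Evaluating [P] before and after the flip must give the same predicate, so
   that [pick] selects the same [e] and the flip is an involution. *)
Lemma even_card_flip X (P : {set E} -> pred E) (F : E -> {set E}) :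
  (forall A, A \in X -> exists e, P A e) ->
  (forall A e, A \in X -> P A e ->
     [/\ e \in F e, flip (F e) A \in X & P (flip (F e) A) =1 P A]) ->
  ~~ odd #|X|.
Proof.
move=> exP flipP.
pose g A := if [pick e | P A e] is Some e then flip (F e) A else A.
have gP A : A \in X -> exists e,
    [/\ g A = flip (F e) A, g (g A) = A, e \in F e & flip (F e) A \in X].
  move=> AX; case pickA: [pick e | P A e] => [e|]; last first.
    by move: pickA; case: pickP => // PA0; have [e] := exP A AX; rewrite PA0.
  have PAe : P A e by move: pickA; case: pickP => // d PAd [<-].
  have [eF fX fP] := flipP A e AX PAe; exists e.
  have gA : g A = flip (F e) A by rewrite /g pickA.
  by split=> //; rewrite gA /g (eq_pick fP) pickA flipK.
apply: (@even_card_involution _ X g) => A /gP[e [gA gK eF fX]] //.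
  by rewrite gA.
apply/eqP=> /setP/(_ e); rewrite gA inE eF.
by case: (e \in A).
Qed.

End Flip.

(** * Reachability, paths and cycles *)

Section Reach.
Variables (V : eqType) (E : finType) (G : multidigraph V E).
Implicit Types (u v x : V) (e d : E) (w : seq (E * V)) (A B : {set E}).

Inductive reach A u : V -> Prop :=
| reach_refl : reach A u u
| reach_step e : e \in A -> reach A u (source G e) -> reach A u (target G e).

Lemma reach_arc A e : e \in A -> reach A (source G e) (target G e).
Proof. by move=> eA; apply: reach_step => //; apply: reach_refl. Qed.

Lemma reach_trans A u v x : reach A u v -> reach A v x -> reach A u x.
Proof. by move=> uv; elim=> // e eA _; apply: reach_step. Qed.

Lemma reach_first A u v : reach A u v ->
  u = v \/ exists e, [/\ e \in A, source G e = u & reach A (target G e) v].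
Proof.
elim=> [|e eA ue [ue'|[d [dA du de]]]]; first by left.
  by right; exists e; split=> //; apply: reach_refl.
by right; exists d; split=> //; apply: reach_step.
Qed.

Lemma reach_last A u v : reach A u v ->
  v = u \/ exists2 e, e \in A & target G e = v.
Proof. by case=> [|e eA _]; [left | right; exists e]. Qed.

Lemma walk_reach A u v w :
  is_walk G u v w -> {subset walk_arcs w <= A} -> reach A u v.
Proof.
elim: w u => [|[e x] w IHw] u; first by move=> /eqP <- _; apply: reach_refl.
rewrite /is_walk /= => /andP[/and3P[/eqP <- /eqP ex wx] wv] wA.
have eA : e \in A by apply: wA; rewrite inE eqxx.
apply: reach_trans (reach_arc eA) _; rewrite ex; apply: IHw.
  by rewrite /is_walk wx.
by move=> d dw; apply: wA; rewrite inE dw orbT.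
Qed.

Lemma path_suffix u v x w : is_path G u v w -> x \in u :: walk_steps w ->
  exists2 w', is_path G x v w' & {subset walk_arcs w' <= walk_arcs w}.
Proof.
elim: w u => [|[e y] w IHw] u.
  by move=> p; rewrite mem_seq1 => /eqP ->; exists [::].
move=> p; rewrite inE => /orP[/eqP ->|xw]; first by exists ((e, y) :: w).
have [] := IHw y _ xw.
  move: p; rewrite /is_path /is_walk /= => /andP[/andP[/and3P[_ _ ->] ->]].
  by case/andP.
by move=> w' pw' sw'; exists w' => // d /sw' dw; rewrite inE dw orbT.
Qed.

Lemma reach_path A u v : reach A u v ->
  exists2 w, is_path G u v w & {subset walk_arcs w <= A}.
Proof.
(* [reach] grows at its end but a walk at its head, so arcs are prepended to an arbitrary path from
   [v]. If the new source already lies on the path, its suffix from there is taken instead. *)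
suff extend : reach A u v -> forall x w, is_path G v x w ->
    {subset walk_arcs w <= A} ->
    exists2 w', is_path G u x w' & {subset walk_arcs w' <= A}.
  by move=> uv; apply: (extend uv v [::]) => //;
    rewrite /is_path /is_walk /= eqxx.
elim=> [|e eA _ IH] x w p wA; first by exists w.
have [sw|sNw] := boolP (source G e \in target G e :: walk_steps w).
  by have [w' p' sub] := path_suffix p sw; apply: IH p' _ => d /sub /wA.
apply: (IH x ((e, target G e) :: w)).
  case/andP: p => /andP[ww wx] wU.
  by rewrite /is_path /is_walk /= !eqxx ww wx sNw.
by move=> d; rewrite inE => /orP[/eqP ->|/wA].
Qed.

Lemma contains_pathE A u v : contains_path G u v A <-> reach A u v.
Proof.
split=> [[w [/andP[ww _] wA]]|/reach_path[w p wA]]; last by exists w.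
exact: walk_reach ww wA.
Qed.

(** By induction, every source used in either derivation is reached in [A], so its arc is outside
    [B]. *)
Lemma reach_flip A B u v : (forall e, e \in B -> ~ reach A u (source G e)) ->
  reach (flip B A) u v <-> reach A u v.
Proof.
move=> BN; have AB e : reach A u (source G e) -> (e \in flip B A) = (e \in A).
  by move=> ue; rewrite inE (_ : e \in B = false) ?addbF //; apply/negP=> /BN.
split; elim=> [|e eA ve ue]; try exact: reach_refl.
  by apply: reach_step => //; rewrite -AB.
by apply: reach_step => //; rewrite AB.
Qed.

(* The arc [d] lies on the cycle. *)
Definition to_cycle v : Prop := exists2 d,
  reach setT v (source G d) & reach setT (target G d) (source G d).

Lemma to_cycle_arc v : to_cycle v ->
  exists2 e, source G e = v & to_cycle (target G e).
Proof.
case=> d /reach_first[->|[e [_ <- ed]]] dd; first by exists d => //; exists d.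
by exists e => //; exists d.
Qed.

Lemma has_cycle_to_cycle : has_cycle G <-> exists e, to_cycle (target G e).
Proof.
split=> [[v [[|[e x] w] /and3P[]]]//|[e [d _ /reach_path[w p _]]]].
  rewrite /is_walk /= => /andP[/and3P[/eqP <- /eqP <- ww] wv] _ _.
  exists e; have ee : reach setT (target G e) (source G e).
    by apply: (@walk_reach _ _ _ w) => [|d _]; rewrite ?inE // /is_walk ww.
  by exists e.
(* [d] is followed by a path back to its source; moving that source from the end to the front keeps
   the vertices distinct. *)
exists (source G d), ((d, target G d) :: w).
case/andP: p => /andP[ww /eqP wv]; rewrite lastI wv => wU.
rewrite /is_cycle /is_walk /= !eqxx ww wv eqxx /=.
by move: wU; rewrite rcons_uniq.
Qed.

(** Arcs are collected because only [E] is finite; the cardinality is the measure for going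
    backwards along arcs. *)
Definition ancestors v : {set E} := [set e | `[< reach setT (target G e) v >]].

(* Otherwise [target G e] would lie on a cycle. *)
Lemma ancestors_proper e : ~ to_cycle (target G e) ->
  ancestors (source G e) \proper ancestors (target G e).
Proof.
move=> ecyc; apply/properP; split.
  apply/subsetP=> d; rewrite !inE => /asboolP de; apply/asboolP.
  exact: reach_step.
exists e; rewrite inE; first by apply/asboolP; apply: reach_refl.
by apply/asboolP=> ee; apply: ecyc; exists e.
Qed.

End Reach.

(** * Arcs and vertices along a walk *)

Section Walks.
Variables (V : eqType) (E : finType) (G : multidigraph V E).
Implicit Types (u v : V) (e d : E) (w : seq (E * V)).

Lemma walk_steps_target u v w : walk_from G u w -> v \in walk_steps w ->
  exists e, target G e = v.
Proof.
elim: w u => // [[e x] w] IHw u /= /and3P[_ /eqP ex wx].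
by rewrite inE => /orP[/eqP ->|]; [exists e | apply: IHw wx].
Qed.

Lemma walk_arc_target u w e : walk_from G u w -> e \in walk_arcs w ->
  target G e \in walk_steps w.
Proof.
elim: w u => // [[d x] w] IHw u /= /and3P[_ /eqP dx wx].
rewrite !inE => /orP[/eqP ->|]; first by rewrite dx eqxx.
by move=> /(IHw _ wx) ->; rewrite orbT.
Qed.

Lemma walk_arc_source u w e : walk_from G u w -> e \in walk_arcs w ->
  source G e = u \/ exists d, target G d = source G e.
Proof.
elim: w u => // [[d x] w] IHw u /= /and3P[/eqP du /eqP dx wx].
rewrite inE => /orP[/eqP ->|ew]; first by left.
by right; case: (IHw _ wx ew) => // ->; exists d.
Qed.

Lemma walk_arc_next u w e : walk_from G u w -> e \in walk_arcs w ->
  target G e = last u (walk_steps w) \/ exists d, source G d = target G e.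
Proof.
elim: w u => // [[d x] w] IHw u /= /and3P[_ /eqP dx wx].
rewrite inE => /orP[/eqP ->|ew]; last exact: IHw wx ew.
case: w wx {IHw} => [|[c y] w] /=; first by left.
by case/andP=> /eqP cx _; right; exists c; rewrite cx dx.
Qed.

End Walks.

Lemma odd_card_setD (T : finType) (X Y : {set T}) :
  X \subset Y -> ~~ odd #|Y :\: X| -> odd #|Y| = odd #|X|.
Proof.
move=> XY /negbTE evenD.
by rewrite -(cardsID X Y) oddD evenD addbF (setIidPr XY).
Qed.

(** * Parity of reaching, spanning and covering arc sets *)

Section Parity.
Variables (V : eqType) (E : finType) (G : multidigraph V E) (s t : V).
Implicit Types (A : {set E}) (e d : E) (v : V).

(** A path avoiding [F] does not use [e], so it also avoids [F] with [e] toggled. *)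
Lemma even_path_missing_useless e :
  useless G s t e -> ~~ odd #|path_missing G s t|.
Proof.
move=> eU; apply: (@even_card_flip _ _ (fun=> pred1 e) (fun e => [set e])).
  by move=> A _; exists e; rewrite /= eqxx.
move=> A d; rewrite [A \in _]inE => /asboolP[w [p wA]] /eqP ->; split=> //.
  by rewrite inE.
rewrite inE; apply/asboolP; exists w; split=> // c cw.
rewrite !inE; have := wA c cw; rewrite inE => /negbTE ->.
by apply/negP=> /eqP ce; apply: eU; exists w; rewrite -ce.
Qed.

Definition reaching v : {set {set E}} := [set A | `[< reach G A s v >]].

Lemma card_path_missing : #|path_missing G s t| = #|reaching t|.
Proof.
rewrite -[RHS](card_imset _ (@setC_inj E)); congr #|pred_of_set _|.
apply/setP=> F; rewrite -[F in RHS]setCK mem_imset; last exact: setC_inj.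
by rewrite !inE; apply: asbool_equiv_eq; apply: contains_pathE.
Qed.

(* If no arc is useless, every non-isolated vertex except [s] is an arc target. *)
Definition spanning : {set {set E}} :=
  [set A : {set E} | [forall e, `[< reach G A s (target G e) >]]].

Definition covering : {set {set E}} :=
  [set A : {set E} | [forall e, `[< to_cycle G (target G e) >] ||
     [exists d, (d \in A) && (target G d == target G e)]]].

Lemma spanningP A :
  reflect (forall e, reach G A s (target G e)) (A \in spanning).
Proof. by rewrite inE; apply: (iffP forallP) => H e; apply/asboolP. Qed.

Lemma coveringP A :
  reflect (forall e, ~ to_cycle G (target G e) ->
             exists2 d, d \in A & target G d = target G e)
    (A \in covering).
Proof.
rewrite inE; apply: (iffP forallP) => H e.
  move=> ecyc; have /orP[/asboolP//|/existsP[d /andP[dA /eqP de]]] := H e.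
  by exists d.
case: asboolP => //= /H[d dA de]; apply/existsP; exists d.
by rewrite dA de eqxx.
Qed.

Lemma covering_flip1 A e : to_cycle G (target G e) ->
  A \in covering -> flip [set e] A \in covering.
Proof.
move=> ecyc /coveringP cA; apply/coveringP=> d dcyc.
have [c cA' cd] := cA d dcyc; exists c => //.
rewrite !inE cA'; apply/negP=> /eqP ce.
by apply: dcyc; rewrite -cd ce.
Qed.

Lemma even_covering e : to_cycle G (target G e) -> ~~ odd #|covering|.
Proof.
move=> ecyc.
apply: (@even_card_flip _ _ (fun=> pred1 e) (fun e => [set e])).
  by move=> A _; exists e; rewrite /= eqxx.
by move=> A d AC /eqP ->; split=> //; [rewrite inE | apply: covering_flip1].
Qed.

(* Complementing inside the arcs into one vertex preserves [covering], if only
   some of these arcs are present. *)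
Lemma odd_covering : ~ has_cycle G -> odd #|covering|.
Proof.
move=> acyc; have Nto e : ~ to_cycle G (target G e).
  by move=> ecyc; apply/acyc/has_cycle_to_cycle; exists e.
(* The full arc set is set aside: it is the only one in which no block is incomplete. *)
rewrite (@odd_card_setD _ [set [set: E]]) ?cards1 //.
  by rewrite sub1set; apply/coveringP=> e _; exists e.
pose block e := [set d | target G d == target G e].
pose missing A e := ~~ (block e \subset A).
apply: (@even_card_flip _ _ missing block) => A.
  rewrite !inE => /andP[AT _]; apply: contrapT => noe; case/negP: AT.
  apply/eqP/setP=> e; rewrite inE; apply: contrapT => eA; apply: noe; exists e.
  by apply/subsetPn; exists e; rewrite ?inE //; apply/negP.
move=> e /setDP[/coveringP cA _] /subsetPn[c cB cA'].
(* The block has [b] present and [c] absent; the flip exchanges their roles. *)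
have [b bA be] := cA e (@Nto e).
have bB : b \in block e by rewrite inE be.
have fP d : missing (flip (block e) A) d = missing A d.
  have [de|de] := eqVneq (target G d) (target G e).
    have -> : missing A d.
      by apply/subsetPn; exists c => //; move: cB; rewrite !inE de.
    by apply/subsetPn; exists b; rewrite !inE ?de ?be ?bA ?eqxx.
  have agree x : x \in block d -> (x \in flip (block e) A) = (x \in A).
    by rewrite !inE => /eqP ->; rewrite (negbTE de) addbF.
  by congr (~~ _); apply/subsetP/subsetP=> sub x xd; have := sub x xd;
    rewrite agree.
split=> //; first by rewrite inE.
have [e' e'A] : exists e', e' \notin flip (block e) A.
  by exists b; rewrite inE bA bB.
rewrite in_setD in_set1; apply/andP; split.
  by apply: contraNneq e'A => ->.
apply/coveringP=> d _; have [de|de] := eqVneq (target G d) (target G e).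
  exists c; first by rewrite inE cB (negbTE cA').
  by move: cB; rewrite inE de => /eqP.
have [x xA xd] := cA d (@Nto d); exists x => //.
by rewrite !inE xA xd (negbTE de).
Qed.

Hypothesis no_useless : forall e, ~ useless G s t e.

Lemma arc_on_path e : exists2 w, is_path G s t w & e \in walk_arcs w.
Proof. by have /contrapT[w [p ew]] := @no_useless e; exists w. Qed.

Lemma source_target e : source G e = s \/ exists d, target G d = source G e.
Proof.
have [w /andP[/andP[ww _] _] ew] := arc_on_path e.
exact: walk_arc_source ww ew.
Qed.

Lemma target_source e : target G e = t \/ exists d, source G d = target G e.
Proof.
have [w /andP[/andP[ww /eqP <-] _] ew] := arc_on_path e.
exact: walk_arc_next ww ew.
Qed.

Lemma target_neq_s e : target G e <> s.
Proof.
have [w /andP[/andP[ww _] /andP[sw _]] ew] := arc_on_path e.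
by move=> es; rewrite -es (walk_arc_target ww ew) in sw.
Qed.

(** If [t] is not [s], some arc exists, and the path through it ends at [t], which is thus an arc
    target. *)
Lemma t_reached A : ~ (#|E| = 0 /\ s <> t) -> A \in spanning -> reach G A s t.
Proof.
move=> nE /spanningP sA; have [->|st] := eqVneq t s; first exact: reach_refl.
have [e _|E0] := pickP (@predT E); last first.
  by case: nE; split; [apply: eq_card0 | apply/eqP; rewrite eq_sym].
have [w /andP[/andP[ww /eqP wt] _] _] := arc_on_path e.
have : t \in s :: walk_steps w by rewrite -wt mem_last.
rewrite inE (negbTE st) /= => /(walk_steps_target ww)[d <-].
exact: sA.
Qed.

Lemma odd_reaching_spanning : ~ (#|E| = 0 /\ s <> t) ->
  odd #|reaching t| = odd #|spanning|.
Proof.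
move=> nE; apply: odd_card_setD.
  by apply/subsetP=> A /(t_reached nE) st; rewrite inE; apply/asboolP.
apply: (@even_card_flip _ _
  (fun A e => ~~ `[< reach G A s (source G e) >]) (fun e => [set e])).
  (* An unreached target is not [t], so some arc leaves it and can be toggled. *)
  move=> A /setDP[]; rewrite inE => /asboolP st Nsp; apply: contrapT => noe.
  case/spanningP: Nsp => e; case: (target_source e) => [->//|[d <-]].
  by apply: contrapT => Nd; apply: noe; exists d; apply/asboolP.
move=> A e /setDP[Ast Nsp] /asboolP Ne.
have fE v : reach G (flip [set e] A) s v <-> reach G A s v.
  by apply: reach_flip => d; rewrite inE => /eqP ->.
split=> [||d]; first by rewrite inE.
  rewrite !in_setD; apply/andP; split.
    by apply: contra Nsp => /spanningP sp; apply/spanningP=> d; apply/fE.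
  by move: Ast; rewrite !inE => /asboolP st; apply/asboolP/fE.
by congr (~~ _); apply: asbool_equiv_eq.
Qed.

(** Going backwards along arcs of [A] shrinks the ancestors strictly until [s] or a vertex leading
    to a cycle is met. *)
Lemma covering_spanning A : A \in covering ->
  (forall e, to_cycle G (target G e) -> reach G A s (target G e)) ->
  A \in spanning.
Proof.
move=> /coveringP cA cyc; apply/spanningP=> e.
have [n] := ubnP #|ancestors G (target G e)|.
elim: n e => // n IHn e ltn.
have [|ecyc] := EM (to_cycle G (target G e)); first exact: cyc.
have [d dA de] := cA e ecyc; rewrite -de; apply: reach_step => //.
have [->|[c cd]] := source_target d; first exact: reach_refl.
rewrite -cd; apply: IHn; rewrite -ltnS; apply: leq_trans ltn; rewrite ltnS.
by rewrite cd -de; apply/proper_card/ancestors_proper; rewrite de.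
Qed.

Lemma odd_covering_spanning : odd #|covering| = odd #|spanning|.
Proof.
apply: odd_card_setD.
  apply/subsetP=> A /spanningP sA; apply/coveringP=> e _.
  by have [/target_neq_s//|] := reach_last (sA e).
(* The unreached source keeps reachability unchanged; the target leading to a cycle keeps the set
   covering. *)
apply: (@even_card_flip _ _ (fun A d => `[< ~ reach G A s (source G d) /\
  to_cycle G (target G d) >]) (fun e => [set e])).
  move=> A /setDP[cA Nsp]; apply: contrapT => noe; case/negP: Nsp.
  apply: covering_spanning => // e /to_cycle_arc[d de dcyc].
  by apply: contrapT => Ne; apply: noe; exists d; apply/asboolP; rewrite de.
move=> A e /setDP[cA Nsp] /asboolP[Ne ecyc].
have fE v : reach G (flip [set e] A) s v <-> reach G A s v.
  by apply: reach_flip => d; rewrite inE => /eqP ->.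
split=> [||d]; first by rewrite inE.
  rewrite in_setD covering_flip1 // andbT.
  by apply: contra Nsp => /spanningP sp; apply/spanningP=> d; apply/fE.
by apply: asbool_equiv_eq; rewrite fE.
Qed.

End Parity.

Theorem corollary1p5 (V : eqType) (E : finType) (G : multidigraph V E)
    (s t : V) :
  let exceptional :=
    (exists e : E, useless G s t e) \/ has_cycle G \/ (#|E| = 0 /\ s <> t) in
  (exceptional -> ~~ odd #|path_missing G s t|) /\
  (~ exceptional -> odd #|path_missing G s t|).
Proof.
move=> exceptional.
have [[e eU]|nU] := EM (exists e : E, useless G s t e).
  split=> [_|[]]; last by left; exists e.
  exact: even_path_missing_useless eU.
have no_useless e : ~ useless G s t e by move=> eU; apply: nU; exists e.
rewrite card_path_missing.
have [nE|nE] := EM (#|E| = 0 /\ s <> t).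
  split=> [_|[]]; last by right; right.
  case: nE => /card0_eq E0 st; rewrite (_ : reaching _ _ _ = set0) ?cards0 //.
  apply/setP=> A; rewrite !inE; apply/asboolP.
  by case/reach_last=> [ts|[e]]; [apply: st | have := E0 e].
rewrite odd_reaching_spanning // -(odd_covering_spanning no_useless).
split=> [[//|[/has_cycle_to_cycle[e]|//]]|nex]; first exact: even_covering.
by apply: odd_covering => cyc; apply: nex; right; left.
Qed.
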